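(* For each $\rho\in\mathcal R$ let $a_\rho\in L^\infty(X,\lambda)$, and suppose there are constants $M,L\ge 0$ such that for all $\rho,\sigma\in\mathcal R$ $$\|a_\rho\|_\infty\le M\qquad\text{and}\qquad \|a_\rho-a_\sigma\|_\infty\le L\|\rho-\sigma\|_1 .$$ Then the map $$\mathbb M:\mathcal H\times\mathcal R\to\mathcal H\times\mathcal R,\qquad \mathbb M(u,\rho)=(a_\rho u,\rho)$$ is locally Lipschitz on $\mathcal H\times\mathcal R$ with respect to the metric $d_\oplus$.
   Context: Let $X=\mathbb R^n$ ($n\ge 1$) with its Borel $\sigma$-algebra and Lebesgue measure $\lambda$; functions are complex-valued. Let $\mathcal H=L^2(X,\lambda)$ with norm $\|\cdot\|_2$, and $\mathcal R=\{\rho\in L^1(X,\lambda):\rho\ge 0\ \lambda\text{-a.e.},\ \int_X\rho\,d\lambda=1\}$ with the $L^1$-metric. The condensation space $\mathcal H\times\mathcal R$ carries the metric $d_\oplus((u,\rho),(v,\sigma))=\|u-v\|_2+\|\rho-\sigma\|_1$. *)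

(* Defs.v *)
From HB Require Import structures.
From mathcomp Require Import all_boot all_order all_algebra.
From mathcomp Require Import all_classical all_reals all_analysis.
From mathcomp Require Import measurable_realfun ess_sup_inf hoelder.
From mathcomp Require Import complex.

Set Implicit Arguments.
Unset Strict Implicit.
Unset Printing Implicit Defensive.

Import Order.TTheory GRing.Theory Num.Theory.
Import numFieldNormedType.Exports.
Import Normc.

Local Open Scope classical_set_scope.
Local Open Scope ring_scope.

(* The Borel sigma-algebra of C = R x R, generated by the preimages of Borel
   sets of R under Re and Im (as the library does for products). *)
Section complex_measurable.
Context (R : realType).

HB.instance Definition _ := isPointed.Build R[i] 0.

Let borelC := g_sigma_preimageU (@complex.Re R) (@complex.Im R).

Let borelC_set0 : borelC set0. Proof. exact: sigma_algebra0. Qed.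

Let borelC_setC A : borelC A -> borelC (~` A).
Proof. exact: sigma_algebraC. Qed.

Let borelC_bigcup (F : _^nat) : (forall i, borelC (F i)) ->
  borelC (\bigcup_i (F i)).
Proof. exact: sigma_algebra_bigcup. Qed.

HB.instance Definition _ := @isMeasurable.Build default_measure_display
  R[i] borelC borelC_set0 borelC_setC borelC_bigcup.

End complex_measurable.

Section complex_measurable_fun.
Context d (T : measurableType d) (R : realType).
Implicit Types f g : T -> R[i].

Lemma measurable_fun_complexP f :
  measurable_fun [set: T] f <->
  measurable_fun [set: T] (fun x => complex.Re (f x)) /\
  measurable_fun [set: T] (fun x => complex.Im (f x)).
Proof.
apply: (@iff_trans _ (g_sigma_preimageU (@complex.Re R \o f)
    (@complex.Im R \o f) `<=` measurable)).
  rewrite g_sigma_preimageU_comp; split=> [mf A [C HC <-]|f12]; first exact: mf.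
  by move=> _ A mA; apply: f12; exists A.
split => [h|[mf1 mf2]].
  split => _ A mA; apply: h; apply: sub_sigma_algebra;
  by [left; exists A|right; exists A].
apply: smallest_sub; first exact: sigma_algebra_measurable.
by rewrite subUset; split=> [|] A [C mC <-]; [exact: mf1|exact: mf2].
Qed.

Lemma measurable_normc f : measurable_fun [set: T] f ->
  measurable_fun [set: T] (fun x => normc (f x)).
Proof.
move=> /measurable_fun_complexP[mr mi].
rewrite (_ : (fun x => _) = fun x =>
  Num.sqrt (complex.Re (f x) ^+ 2 + complex.Im (f x) ^+ 2)); last first.
  by apply/funext => x; case: (f x) => ? ?.
have msqrt : measurable_fun [set: R] (@Num.sqrt R).
  by apply: continuous_measurable_fun; exact: sqrt_continuous.
apply: (measurableT_comp msqrt).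
by apply: measurable_funD; exact: measurable_funX.
Qed.

Lemma measurable_mulc f g :
  measurable_fun [set: T] f -> measurable_fun [set: T] g ->
  measurable_fun [set: T] (fun x => f x * g x).
Proof.
move=> /measurable_fun_complexP[fr fi] /measurable_fun_complexP[gr gi].
apply/measurable_fun_complexP; split.
- rewrite (_ : (fun x => _) = fun x =>
    complex.Re (f x) * complex.Re (g x) - complex.Im (f x) * complex.Im (g x)).
    by apply: measurable_funB; exact: measurable_funM.
  by apply/funext => x; case: (f x) => ? ?; case: (g x).
- rewrite (_ : (fun x => _) = fun x =>
    complex.Re (f x) * complex.Im (g x) + complex.Im (f x) * complex.Re (g x)).
    by apply: measurable_funD; exact: measurable_funM.
  by apply/funext => x; case: (f x) => ? ?; case: (g x).
Qed.

Lemma measurable_subc f g :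
  measurable_fun [set: T] f -> measurable_fun [set: T] g ->
  measurable_fun [set: T] (fun x => f x - g x).
Proof.
move=> /measurable_fun_complexP[fr fi] /measurable_fun_complexP[gr gi].
apply/measurable_fun_complexP; split.
- rewrite (_ : (fun x => _) = fun x => complex.Re (f x) - complex.Re (g x)).
    exact: measurable_funB.
  by apply/funext => x; case: (f x) => ? ?; case: (g x).
- rewrite (_ : (fun x => _) = fun x => complex.Im (f x) - complex.Im (g x)).
    exact: measurable_funB.
  by apply/funext => x; case: (f x) => ? ?; case: (g x).
Qed.

Lemma normc_ge0 (z : R[i]) : 0 <= normc z.
Proof. by case: z => x y; exact: sqrtr_ge0. Qed.

End complex_measurable_fun.

(* R^n is n.-tuple R with the product sigma-algebra of the library, generated
   by the n coordinates. *)
Notation euclid R n := (n.-tuple (measurableTypeR R)).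

Section lebesgue_measure_n.
Context (R : realType).
Local Open Scope ereal_scope.

Definition tuple_consp n (p : measurableTypeR R * euclid R n) : euclid R n.+1 :=
  [tuple of p.1 :: p.2].

Lemma measurable_tuple_consp n :
  measurable_fun [set: measurableTypeR R * euclid R n] (@tuple_consp n).
Proof. exact: measurable_cons. Qed.

Section step.
Context n (m : {sigma_finite_measure set (euclid R n) -> \bar R}).

Definition lebesgue_step : set (euclid R n.+1) -> \bar R :=
  pushforward (lebesgue_measure \x m) (@tuple_consp n).

Let step0 : lebesgue_step set0 = 0.
Proof. by rewrite /lebesgue_step /pushforward preimage_set0 measure0. Qed.

Let step_ge0 A : 0 <= lebesgue_step A.
Proof. by apply: (measure_ge0 (lebesgue_measure \x m)). Qed.

Let step_sigma_additive : semi_sigma_additive lebesgue_step.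
Proof.
pose pf := measure_function_pushforward__canonical__measure_function_Measure.
exact: (@measure_semi_sigma_additive _ _ _
  (pf _ _ _ _ _ (lebesgue_measure \x m) _ (@measurable_tuple_consp n))).
Qed.

HB.instance Definition _ := isMeasure.Build _ _ _ lebesgue_step
  step0 step_ge0 step_sigma_additive.

Let step_sigma_finite : sigma_finite setT lebesgue_step.
Proof.
have /sigma_finiteP[F [TF ndF Foo]] :=
  sigma_finiteT (@lebesgue_measure R : {sigma_finite_measure set _ -> \bar R}).
have /sigma_finiteP[G [TG ndG Goo]] := sigma_finiteT m.
pose g (x : euclid R n.+1) : measurableTypeR R * euclid R n :=
  (thead x, [tuple of behead x]).
have mg : measurable_fun setT g.
  by apply: measurable_fun_pair;
    [exact: measurable_tnth|exact: measurable_behead].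
exists (fun k => g @^-1` (F k `*` G k)).
  apply/esym/seteqP; split => // x _.
  have [k _ Fk] : (\bigcup_i F i) (thead x) by rewrite -TF.
  have [l _ Gl] : (\bigcup_i G i) [tuple of behead x] by rewrite -TG.
  exists (maxn k l) => //; split => /=.
  - by move: Fk; exact/subsetPset/ndF/leq_maxl.
  - by move: Gl; exact/subsetPset/ndG/leq_maxr.
move=> k; have [mF Fk] := Foo k; have [mG Gk] := Goo k; split.
  by rewrite -[X in measurable X]setTI; apply: mg => //; exact: measurableX.
rewrite /lebesgue_step /pushforward -comp_preimage.
rewrite (_ : g \o _ = id) ?preimage_id.
  by rewrite product_measure1E// lte_mul_pinfty// ge0_fin_numE.
apply/funext => -[x t]; rewrite /g /tuple_consp /=; congr pair.
exact: val_inj.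
Qed.

HB.instance Definition _ := Measure_isSigmaFinite.Build _ _ _ lebesgue_step
  step_sigma_finite.

End step.

(* n-dimensional Lebesgue measure, as the n-fold product of the Lebesgue
   measure of R; characterised by lebesgue_n_box below. *)
Fixpoint lebesgue_n n : {sigma_finite_measure set (euclid R n) -> \bar R} :=
  match n with
  | 0 => \d_([tuple] : euclid R 0)
  | k.+1 => lebesgue_step (lebesgue_n k)
  end.

Lemma lebesgue_n_box n (A : 'I_n -> set R) : (forall i, measurable (A i)) ->
  lebesgue_n n [set x | forall i, A i (tnth x i)] =
  \prod_(i < n) lebesgue_measure (A i).
Proof.
elim: n A => [|n ih] A mA.
  by rewrite big_ord0 /= diracE mem_set//= => -[].
rewrite big_ord_recl -ih//= /lebesgue_step /pushforward -product_measure1E//.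
- congr (product_measure1 _ _ _); apply/seteqP; split => [[x t]|[x t]] /=.
  + move=> h; split; first by have := h ord0; rewrite (tnth_nth 0%R).
    by move=> i; have := h (lift ord0 i); rewrite /tuple_consp tnthS.
  + move=> [Ax At] i; case: (unliftP ord0 i) => [j ->|->].
      by rewrite /tuple_consp tnthS; exact: At.
    by rewrite (tnth_nth 0%R).
- exact: mA.
- rewrite (_ : [set x | _] = \bigcap_(i : 'I_n)
      ((fun x => tnth x i) @^-1` A (lift ord0 i))); last first.
    by apply/seteqP; split => x /= h i; [move=> _|]; exact: h.
  apply: fin_bigcap_measurable => // i _.
  rewrite -[X in measurable X]setTI.
  by apply: (@measurable_tnth _ (measurableTypeR R)) => //; exact: mA.
Qed.

End lebesgue_measure_n.

Section Lnorm_ae.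
Context d (T : measurableType d) (R : realType).
Variable mu : {measure set T -> \bar R}.
Local Open Scope ereal_scope.
Implicit Types (f g : T -> R) (p : \bar R).

Lemma ae_le_Lnorm f g p : 1 <= p ->
  measurable_fun [set: T] f -> measurable_fun [set: T] g ->
  {ae mu, forall x, `|f x| <= `|g x|}%R ->
  'N[mu]_p[EFin \o f] <= 'N[mu]_p[EFin \o g].
Proof.
case: p => [r| |//] r1 mf mg fg.
  have r0 : (0 < r)%R by rewrite (lt_le_trans ltr01).
  have mpow (h : T -> R) : measurable_fun [set: T] h ->
      measurable_fun [set: T] (fun x => `|(h x)%:E| `^ r).
    move=> mh; under eq_fun do rewrite abse_EFin poweR_EFin.
    apply/measurable_EFinP; apply: measurableT_comp (measurable_powR r) _.
    exact: measurableT_comp.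
  rewrite unlock; apply: gt0_ler_poweR.
  - by rewrite invr_ge0 ltW.
  - by rewrite in_itv /= leey andbT integral_ge0// => x _; exact: poweR_ge0.
  - by rewrite in_itv /= leey andbT integral_ge0// => x _; exact: poweR_ge0.
  apply: ae_ge0_le_integral => //.
  - by move=> x _; exact: poweR_ge0.
  - exact: mpow.
  - by move=> x _; exact: poweR_ge0.
  - exact: mpow.
  apply: filterS fg => x fgx _; rewrite !abse_EFin !poweR_EFin lee_fin.
  by rewrite ge0_ler_powR// ?nnegrE// ltW.
rewrite unlock; case: ifPn => // _.
by apply: le_ess_sup; apply: filterS fg => x fgx; rewrite /= lee_fin.
Qed.

Lemma ae_eq_Lnorm f g p : 1 <= p ->
  measurable_fun [set: T] f -> measurable_fun [set: T] g ->
  {ae mu, forall x, f x = g x} ->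
  'N[mu]_p[EFin \o f] = 'N[mu]_p[EFin \o g].
Proof.
move=> p1 mf mg fg; apply/eqP; rewrite eq_le; apply/andP; split;
  by apply: ae_le_Lnorm => //; apply: filterS fg => x ->.
Qed.

Lemma Lnormy_ae_bounded f : 'N[mu]_(+oo)[EFin \o f] < +oo ->
  exists c : R, {ae mu, forall x, `|f x| <= c}%R.
Proof.
rewrite unlock; case: ifPn => [_|]; last first.
  rewrite -leNgt => mu0 _; exists 0%R, setT; split => //.
  by apply/eqP; rewrite eq_le mu0 measure_ge0.
have := ess_sup_ge mu (abse \o (EFin \o f)).
case: ess_sup => [c|//|] h _; first by exists c; apply: filterS h => x /=.
by exists 0%R; apply: filterS h => x /=.
Qed.

End Lnorm_ae.

Section Lp_spaces.
Context (R : realType) (n : nat).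
Local Notation X := (euclid R n).
Local Notation lam := (lebesgue_n R n).
Local Notation C := R[i].
Local Open Scope quotient_scope.

Definition cLnorm (p : \bar R) (f : X -> C) : \bar R :=
  ('N[lam]_p[EFin \o (@normc R \o f)])%E.

Definition cintegral (f : X -> C) : C :=
  Complex (\int[lam]_x complex.Re (f x)) (\int[lam]_x complex.Im (f x)).

(* Elements are classes for equality almost everywhere; the coercion to
   functions picks a representative. *)
Record Lp (p : \bar R) := MkLp {
  Lp_class :> {mfun_ lam, X >-> C};
  Lp_finite : (cLnorm p Lp_class < +oo)%E
}.

Lemma measurable_Lp p (f : Lp p) : measurable_fun [set: X] (f : X -> C).
Proof. exact: measurable_funPT. Qed.

Lemma Lp_eqP p (f g : Lp p) :
  f = g <-> {ae lam, forall x, f x = g x}.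
Proof.
split=> [->|fg]; first by apply: filterS (ae_eq_refl lam setT g).
have {}fg : Lp_class f = Lp_class g.
  rewrite -[LHS]reprK -[RHS]reprK; apply/eqP/ae_eqP.
  by apply: filterS fg => x /= fgx _; rewrite fgx.
case: f g fg => f ff [g fg] /= fgE; rewrite -{g}fgE in fg *.
by congr MkLp; exact: Prop_irrelevance.
Qed.

(* The norm of f - g, which is finite by finite_cLnormB. *)
Definition Lp_dist p (f g : Lp p) : R := fine (cLnorm p (fun x => f x - g x)).

Lemma finite_cLnormB p (f g : Lp p) : (1 <= p)%E ->
  (cLnorm p (fun x => f x - g x)%R < +oo)%E.
Proof.
move=> p1; pose h x := normc (f x) + normc (g x).
have mf := measurable_normc (measurable_Lp f).
have mg := measurable_normc (measurable_Lp g).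
have mfg : measurable_fun [set: X] (fun x => f x - g x).
  exact: measurable_subc (measurable_Lp f) (measurable_Lp g).
apply: (@le_lt_trans _ _ ('N[lam]_p[EFin \o h])%E); last first.
  apply: le_lt_trans (eminkowski _ mf mg p1) _.
  by apply: lte_add_pinfty; exact: Lp_finite.
apply: ae_le_Lnorm => //.
- exact: measurable_normc.
- exact: measurable_funD.
apply: aeW => x /=; rewrite !ger0_norm ?addr_ge0 ?normc_ge0//.
rewrite /h; have <- : normc (- g x) = normc (g x) := normcN (g x).
exact: (le_normcD (f x) (- g x)).
Qed.

Section class.
Context (f : X -> C) (mf : measurable_fun [set: X] f).

Let mf_mixin := isMeasurableFun.Build _ _ _ _ _ mf.
Let mf_pack : {mfun X >-> C} := HB.pack f mf_mixin.

Definition mfun_class : {mfun_ lam, X >-> C} := \pi mf_pack.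

Lemma mfun_classE : {ae lam, forall x, mfun_class x = f x}.
Proof.
have /eqmodP/asboolP : \pi_({mfun_ lam, X >-> C}) (repr mfun_class) =
    \pi_({mfun_ lam, X >-> C}) mf_pack by rewrite reprK.
by apply: filterS => x; exact.
Qed.

Lemma cLnorm_class p : (1 <= p)%E -> cLnorm p mfun_class = cLnorm p f.
Proof.
move=> p1; apply: ae_eq_Lnorm => //.
- by apply: measurable_normc; exact: measurable_funPT.
- exact: measurable_normc.
- by apply: filterS mfun_classE => x /= ->.
Qed.

End class.

Section product.
Context (a : Lp +oo) (u : Lp 2).

Lemma measurable_Lp_mul : measurable_fun [set: X] (fun x => a x * u x).
Proof. by apply: measurable_mulc; exact: measurable_Lp. Qed.

Lemma finite_cLnorm_mul :
  (cLnorm 2 (mfun_class measurable_Lp_mul) < +oo)%E.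
Proof.
have p1 : (1 <= 2%:E :> \bar R)%E by rewrite lee_fin ler1n.
rewrite cLnorm_class//.
have [c ac] := Lnormy_ae_bounded (Lp_finite a).
have mnu := measurable_normc (measurable_Lp u).
have uL : (@normc R \o u : X -> R) \in Lfun lam 2%:E.
  rewrite inE; apply/andP; split; rewrite inE //=; exact: Lp_finite.
have cuL : (c *: (@normc R \o u : X -> R)) \in Lfun lam 2%:E.
  by have [L0 /(_ c _ _ uL L0)] := Lfun_submod_closed lam p1; rewrite addr0.
have cu_finite : ('N[lam]_(2%:E)[EFin \o (c *: (@normc R \o u : X -> R))] < +oo)%E.
  by move: cuL; rewrite inE => /andP[_]; rewrite inE.
apply: le_lt_trans cu_finite; apply: ae_le_Lnorm => //.
- exact: measurable_normc measurable_Lp_mul.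
- by apply: measurable_funM.
apply: filterS ac => x /= acx; rewrite normcM /GRing.scale /= !normrM.
rewrite ler_wpM2r//; exact: le_trans (ler_norm _).
Qed.

(* The class of the pointwise product, see mfun_classE. *)
Definition Lp_mul : Lp 2 := MkLp finite_cLnorm_mul.

End product.

(* 0 <= z on R[i] means that z is real and nonnegative. *)
Record density := MkDensity {
  density_L1 :> Lp 1;
  density_ge0 : {ae lam, forall x, 0 <= density_L1 x};
  density_int1 : cintegral density_L1 = 1
}.

Definition condensation : Type := Lp 2 * density.

Definition dist_oplus (x y : condensation) : R :=
  Lp_dist x.1 y.1 + Lp_dist x.2 y.2.

Definition condensation_map (a : density -> Lp +oo) (x : condensation) :
  condensation := (Lp_mul (a x.2) x.1, x.2).

End Lp_spaces.

Arguments Lp R n p%_ereal_scope : clear implicits.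

Definition locally_lipschitz (R : realType) (S T : Type) (dS : S -> S -> R)
    (dT : T -> T -> R) (F : S -> T) : Prop :=
  forall x, exists2 r : R, 0 < r &
    exists2 K : R, 0 <= K & forall y z, dS x y < r -> dS x z < r ->
      dT (F y) (F z) <= K * dS y z.

(* Main.v *)
(* Writing a_rho u - a_sigma v = a_rho (u - v) + (a_rho - a_sigma) v gives
   ||a_rho u - a_sigma v||_2 <= M ||u - v||_2 + L ||rho - sigma||_1 ||v||_2,
   and ||v||_2 <= ||w||_2 + 1 on the ball of radius 1 around (w, tau). *)

Require Import Defs.
From mathcomp Require Import all_boot all_order all_algebra.
From mathcomp Require Import all_classical all_reals all_analysis.
From mathcomp Require Import complex measurable_realfun hoelder ess_sup_inf.
From mathcomp Require Import lra.

Set Implicit Arguments.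
Unset Strict Implicit.
Unset Printing Implicit Defensive.

Import Order.TTheory GRing.Theory Num.Theory.
Import numFieldNormedType.Exports.
Import Normc.

Local Open Scope classical_set_scope.
Local Open Scope ring_scope.

Section Lnorm_pointwise_bounds.
Context d (T : measurableType d) (R : realType).
Context (mu : {measure set T -> \bar R}).
Local Open Scope ereal_scope.

(** The essential supremum of [|f|] is attained as an almost-everywhere bound, so any [c] above it
    is one too. *)
Lemma Lnormy_le_ae (f : T -> R) (c : R) :
  'N[mu]_(+oo)[EFin \o f] <= c%:E -> {ae mu, forall x, `|f x| <= c}%R.
Proof.
rewrite unlock; case: ifPn => [_ /ess_supP|].
  by apply: filterS => x /=.
(* If [mu] has total mass zero, the norm takes its default value; the whole space is then the
   exceptional null set. *)
rewrite -leNgt => mu0 _; exists setT; split => //.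
by apply/eqP; rewrite eq_le mu0 measure_ge0.
Qed.

Lemma Lnorm_scale (f : T -> R) (c : R) (p : \bar R) : 1 <= p ->
  measurable_fun [set: T] f -> 'N[mu]_p[EFin \o f] < +oo ->
  'N[mu]_p[EFin \o (c \*: f)%R] = `|c|%:E * 'N[mu]_p[EFin \o f].
Proof.
move=> p1 mf ff.
have fL : f \in Lfun mu p by rewrite inE; apply/andP; split; rewrite inE.
exact: (LnormZ (Lfun_Sub p1 fL)).
Qed.

(** Monotonicity of the norm followed by Minkowski for [b|g|] and [c|h|]; both triangle-type
    estimates below are instances. *)
Lemma Lnorm_le_comb (f g h : T -> R) (b c : R) (p : \bar R) : 1 <= p ->
  (0 <= b)%R -> (0 <= c)%R ->
  measurable_fun [set: T] f -> measurable_fun [set: T] g ->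
  measurable_fun [set: T] h ->
  'N[mu]_p[EFin \o g] < +oo -> 'N[mu]_p[EFin \o h] < +oo ->
  {ae mu, forall x, `|f x| <= b * `|g x| + c * `|h x|}%R ->
  'N[mu]_p[EFin \o f] <=
    b%:E * 'N[mu]_p[EFin \o g] + c%:E * 'N[mu]_p[EFin \o h].
Proof.
move=> p1 b0 c0 mf mg mh gf hf fgh.
have absN (k : T -> R) : measurable_fun [set: T] k ->
    'N[mu]_p[EFin \o (fun x => `|k x|)%R] = 'N[mu]_p[EFin \o k].
  move=> mk; apply/eqP; rewrite eq_le.
  by apply/andP; split; apply: ae_le_Lnorm => //;
    (try exact: measurableT_comp); apply: aeW => x; rewrite normr_id.
have mag : measurable_fun [set: T] (fun x => `|g x|)%R
  by exact: measurableT_comp.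
have mah : measurable_fun [set: T] (fun x => `|h x|)%R
  by exact: measurableT_comp.
(* Writing [b] and [c] as absolute values lets homogeneity be read backwards, pulling them inside
   the norms. *)
rewrite -(absN g)// -(absN h)// -{1}(ger0_norm b0) -{1}(ger0_norm c0).
rewrite -!Lnorm_scale ?absN//.
have mbg : measurable_fun [set: T] (b \*: (fun x => `|g x|))%R.
  exact: measurable_funM.
have mch : measurable_fun [set: T] (c \*: (fun x => `|h x|))%R.
  exact: measurable_funM.
apply: le_trans (eminkowski _ mbg mch p1).
apply: ae_le_Lnorm => //; first exact: measurable_funD.
apply: filterS fgh => x /le_trans; apply; exact: ler_norm.
Qed.

End Lnorm_pointwise_bounds.

Section Lp_metric.
Context (R : realType) (n : nat).
Local Notation X := (euclid R n).
Local Notation lam := (lebesgue_n R n).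

Definition Lp_norm p (f : Lp R n p) : R := fine (cLnorm p f).

Lemma Lp_norm_ge0 p (f : Lp R n p) : 0 <= Lp_norm f.
Proof. by rewrite fine_ge0// Lnorm_ge0. Qed.

Lemma Lp_dist_ge0 p (f g : Lp R n p) : 0 <= Lp_dist f g.
Proof. by rewrite fine_ge0// Lnorm_ge0. Qed.

Lemma measurable_LpB p (f g : Lp R n p) :
  measurable_fun [set: X] (fun x => f x - g x).
Proof. exact: measurable_subc (measurable_Lp f) (measurable_Lp g). Qed.

Lemma EFin_Lp_norm p (f : Lp R n p) : (Lp_norm f)%:E = cLnorm p f.
Proof. by rewrite fineK// ge0_fin_numE ?Lp_finite// Lnorm_ge0. Qed.

(** [fine] would send an infinite norm to 0; Minkowski, hence [1 <= p], excludes this for a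
    difference. *)
Lemma EFin_Lp_dist p (f g : Lp R n p) : (1 <= p)%E ->
  (Lp_dist f g)%:E = cLnorm p (fun x => f x - g x).
Proof.
by move=> p1; rewrite fineK// ge0_fin_numE ?finite_cLnormB// Lnorm_ge0.
Qed.

Lemma cLnormy_le_ae (f : X -> R[i]) (c : R) : (cLnorm +oo f <= c%:E)%E ->
  {ae lam, forall x, normc (f x) <= c}.
Proof.
move=> /Lnormy_le_ae; apply: filterS => x /=.
by rewrite ger0_norm// normc_ge0.
Qed.

Lemma cLnorm_le_comb (f g h : X -> R[i]) (b c : R) (p : \bar R) : (1 <= p)%E ->
  0 <= b -> 0 <= c ->
  measurable_fun [set: X] f -> measurable_fun [set: X] g ->
  measurable_fun [set: X] h ->
  (cLnorm p g < +oo)%E -> (cLnorm p h < +oo)%E ->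
  {ae lam, forall x, normc (f x) <= b * normc (g x) + c * normc (h x)} ->
  (cLnorm p f <= b%:E * cLnorm p g + c%:E * cLnorm p h)%E.
Proof.
move=> p1 b0 c0 /measurable_normc mf /measurable_normc mg /measurable_normc mh.
move=> gf hf fgh; apply: Lnorm_le_comb => //.
by apply: filterS fgh => x /=; rewrite !ger0_norm// normc_ge0.
Qed.

(** Triangle inequality for [g = f - (f - g)], with both coefficients equal to 1. *)
Lemma Lp_norm_le_dist p (f g : Lp R n p) : (1 <= p)%E ->
  Lp_norm g <= Lp_norm f + Lp_dist f g.
Proof.
move=> p1; rewrite -lee_fin EFinD !EFin_Lp_norm EFin_Lp_dist//.
rewrite -(mul1e (cLnorm p f)) -(mul1e (cLnorm p (fun x => f x - g x)%R)).
apply: cLnorm_le_comb => //; try exact: measurable_Lp; try exact: Lp_finite.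
- exact: measurable_LpB.
- exact: finite_cLnormB.
apply: aeW => x; rewrite !mul1r -(normcN (f x - g x)).
by apply: le_trans (le_normcD _ _); rewrite opprB addrC subrK.
Qed.

Lemma Lp_mul_dist_le (a b : Lp R n +oo) (u v : Lp R n 2) (M c : R) :
  0 <= M -> 0 <= c -> (cLnorm +oo a <= M%:E)%E ->
  (cLnorm +oo (fun x => a x - b x)%R <= c%:E)%E ->
  Lp_dist (Lp_mul a u) (Lp_mul b v) <= M * Lp_dist u v + c * Lp_norm v.
Proof.
have p1 : (1 <= 2%:E :> \bar R)%E by rewrite lee_fin ler1n.
move=> M0 c0 /cLnormy_le_ae aM /cLnormy_le_ae abc.
rewrite -lee_fin (EFinD (M * _)) (EFinM M) (EFinM c) EFin_Lp_norm !EFin_Lp_dist//.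
apply: cLnorm_le_comb => //; try exact: measurable_LpB; try exact: measurable_Lp.
- exact: finite_cLnormB.
- exact: Lp_finite.
(* The representative of a product class equals the pointwise product only almost everywhere, so the
   algebraic splitting is done off a null set. *)
have auE := mfun_classE (measurable_Lp_mul a u).
have bvE := mfun_classE (measurable_Lp_mul b v).
near=> x.
have -> : Lp_mul a u x = a x * u x by near: x.
have -> : Lp_mul b v x = b x * v x by near: x.
have -> : a x * u x - b x * v x = a x * (u x - v x) + (a x - b x) * v x.
  by rewrite mulrBr mulrBl addrA subrK.
apply: le_trans (le_normcD _ _) _; rewrite !normcM lerD// ler_wpM2r ?normc_ge0//.
  by near: x.
by near: x.
Unshelve. all: by end_near.
Qed.

End Lp_metric.

Theorem proposition10p1 (R : realType) (n : nat) (n_ge1 : (1 <= n)%N)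
    (a : density R n -> Lp R n +oo) (M L : R) (M_ge0 : 0 <= M) (L_ge0 : 0 <= L)
    (a_bounded : forall rho : density R n, (cLnorm +oo (a rho) <= M%:E)%E)
    (a_lipschitz : forall rho sigma : density R n,
      (cLnorm +oo (fun x => (a rho x - a sigma x)%R)
        <= (L * Lp_dist rho sigma)%:E)%E) :
  locally_lipschitz (@dist_oplus R n) (@dist_oplus R n) (condensation_map a).
Proof.
have p1 : (1 <= 2%:E :> \bar R)%E by rewrite lee_fin ler1n.
move=> [w tau]; exists 1 => //.
(* [N] bounds the norm of [v] throughout the unit ball around [(w, tau)]. *)
set N := Lp_norm w + 1.
have N0 : 0 <= N by rewrite addr_ge0// Lp_norm_ge0.
(* [M] pays for the change of [u], [L * N] for the change of the multiplier, and 1 for the unchanged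
   second component. *)
exists (M + 1 + L * N); first by rewrite !addr_ge0// mulr_ge0.
move=> [u rho] [v sigma] _; rewrite /dist_oplus /= => wv1.
have vN : Lp_norm v <= N.
  apply: le_trans (Lp_norm_le_dist w v p1) _; rewrite lerD2l ltW//.
  by apply: le_lt_trans wv1; rewrite lerDl Lp_dist_ge0.
have d0 := Lp_dist_ge0 rho sigma; have e0 := Lp_dist_ge0 u v.
have := Lp_mul_dist_le u v M_ge0 (mulr_ge0 L_ge0 d0)
  (a_bounded rho) (a_lipschitz rho sigma).
move=> /le_trans; rewrite -lerBrDr; apply.
have : L * Lp_dist rho sigma * Lp_norm v <= L * Lp_dist rho sigma * N.
  by rewrite ler_wpM2l// mulr_ge0.
(* Expanding the constant times the sum of the two distances leaves these nonnegative cross terms as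
   surplus. *)
have := mulr_ge0 (mulr_ge0 L_ge0 N0) e0; have := mulr_ge0 M_ge0 d0.
nra.
Qed.
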